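(* Let $\mathcal X$ be a linear space over the field $\mathbb K$ of real or complex numbers with $\dim\mathcal X=\aleph$, an infinite cardinal. Then there exist at least $2^{\aleph}\cdot\mathfrak c$ many pairs of orderly independent norms on $\mathcal X$, where $\mathfrak c$ is the cardinality of $\mathbb R$; that is, the set of pairs $\{f,g\}$ of norms on $\mathcal X$ such that $f,g$ are orderly independent has cardinality at least $2^{\aleph}\cdot\mathfrak c$.
   Context: $\mathcal N(\mathcal X)$ is the set of all norms on $\mathcal X$ together with the zero function $O$, with pointwise addition, $(\alpha f)(x)=|\alpha|f(x)$ for $\alpha\in\mathbb K$, and $f\le g$ iff $f(x)\le g(x)$ for all $x\in\mathcal X$; its set of minimal elements is $\{O\}$. For $f\in\mathcal N(\mathcal X)\setminus\{O\}$, $L(f):=\{g\in\mathcal N(\mathcal X):g\ge\alpha f\text{ for some }\alpha\in\mathbb K\setminus\{0\}\}$. Two elements $f,g\in\mathcal N(\mathcal X)\setminus\{O\}$ are orderly independent if neither $f\in L(g)$ nor $g\in L(f)$. Here $\dim\mathcal X$ is the cardinality of a Hamel basis of $\mathcal X$. *)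

(* Defs.v *)
From HB Require Import structures.
From mathcomp Require Import all_boot all_order all_algebra.
From mathcomp Require Import complex.
From mathcomp Require Import boolp classical_sets functions cardinality reals.

Set Implicit Arguments.
Unset Strict Implicit.
Unset Printing Implicit Defensive.

Import Order.TTheory GRing.Theory Num.Theory.

Local Open Scope classical_set_scope.
Local Open Scope card_scope.
Local Open Scope ring_scope.

Variant scalar_kind := RealScalars | ComplexScalars.

Definition scalars (R : realType) (k : scalar_kind) : numFieldType :=
  match k with
  | RealScalars => R
  | ComplexScalars => R[i]
  end.

(* The library norm on R[i] takes its values in R[i]; norms on a linear space
   are real-valued here, so the absolute value of a scalar is taken in R. *)
Definition modulus (R : realType) (k : scalar_kind) : scalars R k -> R :=
  match k return scalars R k -> R with
  | RealScalars => fun a : R => `|a|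
  | ComplexScalars => fun a : R[i] => Normc.normc a
  end.

Section HamelBasis.
Variables (K : fieldType) (X : lmodType K).

Definition linearly_independent (B : set X) : Prop :=
  forall (s : seq X) (c : X -> K),
    uniq s -> [set` s] `<=` B -> \sum_(x <- s) c x *: x = 0 ->
    forall x, x \in s -> c x = 0.

Definition spanning (B : set X) : Prop :=
  forall y : X, exists (s : seq X) (c : X -> K),
    [set` s] `<=` B /\ y = \sum_(x <- s) c x *: x.

Definition hamel_basis (B : set X) : Prop :=
  linearly_independent B /\ spanning B.

(* The cardinal number aleph is represented by a type of that cardinality. *)
Definition has_dim (aleph : Type) : Prop :=
  exists2 B : set X, hamel_basis B & B #= [set: aleph].

End HamelBasis.

Section Norms.
Variables (R : realType) (k : scalar_kind) (X : lmodType (scalars R k)).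
Implicit Types f g : X -> R.

Definition is_norm f : Prop :=
  [/\ forall x, 0 <= f x,
      forall x, f x = 0 -> x = 0,
      forall (a : scalars R k) x, f (a *: x) = modulus a * f x &
      forall x y, f (x + y) <= f x + f y].

Definition norm_space : set (X -> R) := [set f | is_norm f \/ f = cst 0].

Definition norm_scale (a : scalars R k) f : X -> R := fun x => modulus a * f x.

(* The order on X -> R is the library's pointwise order. *)
Definition L f : set (X -> R) :=
  [set g | norm_space g /\
           exists2 a : scalars R k, a != 0 & (norm_scale a f <= g)%O].

Definition orderly_independent f g : Prop :=
  [/\ (norm_space `\ cst 0) f, (norm_space `\ cst 0) g, ~ L g f & ~ L f g].

(* Unordered pairs are represented as two-element sets. *)
Definition orderly_independent_norm_pairs : set (set (X -> R)) :=
  [set P | exists f g, [/\ is_norm f, is_norm g, orderly_independent f g &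
                           P = [set f; g]]].

End Norms.

Arguments orderly_independent_norm_pairs {R k} X _.

(* Main.v *)
(** Fix a Hamel basis [B].  A positive weight [w] on [B] gives the weighted
    l^1-norm [x |-> sum_b w b * |x_b|], and one such norm dominates a multiple of
    another only if the same holds for the weights.  Hence every weight which is
    neither bounded nor bounded away from [0] yields a norm orderly independent of
    the one with weight [1].  Starting from one such weight [u], the weights
    [u * (1 + t + 1_A)] with [0 < t < 1] and [A] a subset of [B] all have this
    property, and [t] and [A] can be read off: [t + 1_A b] lies in (0, 1) when [b]
    is not in [A] and in (1, 2) when it is.  Since one member of the pair
    is fixed, distinct [(A, t)] give distinct unordered pairs. *)

Require Import Defs.
From HB Require Import structures.
From mathcomp Require Import all_boot all_order all_algebra.
From mathcomp Require Import complex.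
From mathcomp Require Import boolp classical_sets functions cardinality reals.
From mathcomp Require Import lra.

Set Implicit Arguments.
Unset Strict Implicit.
Unset Printing Implicit Defensive.

Import Order.TTheory GRing.Theory Num.Theory.

Local Open Scope classical_set_scope.
Local Open Scope card_scope.
Local Open Scope ring_scope.

(** * Absolute values of real and complex scalars *)

Section Modulus.
Variables (R : realType) (k : scalar_kind).
Implicit Types a b : scalars R k.

Lemma modulus_ge0 a : 0 <= modulus a.
Proof. by case: k a => [a|[u v]] //=; exact: sqrtr_ge0. Qed.

Lemma modulus0 : modulus (0 : scalars R k) = 0.
Proof. by case: k => /=; [exact: normr0|exact: ComplexField.Normc.normc0]. Qed.

Lemma modulus1 : modulus (1 : scalars R k) = 1.
Proof. by case: k => /=; [exact: normr1|exact: ComplexField.Normc.normc1]. Qed.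

Lemma modulus0_eq0 a : modulus a = 0 -> a = 0.
Proof.
by case: k a => a /=; [exact: normr0_eq0|exact: ComplexField.Normc.eq0_normc].
Qed.

Lemma modulusM a b : modulus (a * b) = modulus a * modulus b.
Proof.
by case: k a b => a b; [exact: normrM|exact: ComplexField.Normc.normcM].
Qed.

Lemma modulusD a b : modulus (a + b) <= modulus a + modulus b.
Proof. by case: k a b => a b; [exact: ler_normD|exact: le_normcD]. Qed.

End Modulus.

(** Sums over different lists become comparable once both are written over a common duplicate-free
    list; entries missing from [s] get multiplicity zero. *)
Lemma sum_count (V : nmodType) (I : eqType) (s t : seq I) (F : I -> V) :
  uniq t -> {subset s <= t} ->
  \sum_(i <- s) F i = \sum_(i <- t) F i *+ count_mem i s.
Proof.
move=> ut; elim: s => [|a s IH] st; first by rewrite big_nil big1.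
have at_ : a \in t by apply: st; exact: mem_head.
rewrite big_cons IH; last by move=> i si; apply: st; rewrite inE si orbT.
under [RHS]eq_bigr do rewrite /= mulrnDr.
rewrite big_split /=; congr (_ + _).
rewrite (bigD1_seq a) //= eqxx mulr1n big1 ?addr0 // => i /negPf ia.
by rewrite eq_sym ia.
Qed.

(** * Coordinates with respect to a Hamel basis *)

Section HamelRepresentation.
Variables (K : fieldType) (X : lmodType K) (B : set X).
Hypothesis hB : hamel_basis B.

Lemma common_representation (x y : X) :
  exists t c d, [/\ uniq t, [set` t] `<=` B,
    x = \sum_(b <- t) c b *: b & y = \sum_(b <- t) d b *: b].
Proof.
have [_ sB] := hB.
have [s [c [sBs ->]]] := sB x; have [s' [d [sBs' ->]]] := sB y.
(* Lists given by [spanning] may repeat a vector, so multiplicities are absorbed into the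
   coefficients. *)
exists (undup (s ++ s')), (fun b => c b *+ count_mem b s),
  (fun b => d b *+ count_mem b s'); split; first exact: undup_uniq.
- move=> b /=; rewrite mem_undup mem_cat => /orP[bs|bs].
    exact: sBs.
  exact: sBs'.
- rewrite (sum_count (t := undup (s ++ s'))) ?undup_uniq //.
    by apply: eq_bigr => b _; rewrite scalerMnl.
  by move=> b bs; rewrite mem_undup mem_cat bs.
- rewrite (sum_count (t := undup (s ++ s'))) ?undup_uniq //.
    by apply: eq_bigr => b _; rewrite scalerMnl.
  by move=> b bs; rewrite mem_undup mem_cat bs orbT.
Qed.

(** Coefficients are arbitrary off their lists, so they are cut off by membership; independence then
    applies to their difference on the union of the lists. *)
Lemma representation_unique (s t : seq X) (c d : X -> K) :
  uniq s -> uniq t -> [set` s] `<=` B -> [set` t] `<=` B ->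
  \sum_(b <- s) c b *: b = \sum_(b <- t) d b *: b ->
  forall b, c b *+ (b \in s) = d b *+ (b \in t).
Proof.
move=> us ut sB tB eq_st b.
have [iB _] := hB.
case: (boolP (b \in s ++ t)); last first.
  by rewrite mem_cat negb_or => /andP[/negPf -> /negPf ->].
rewrite -mem_undup => bu; apply/eqP; rewrite -subr_eq0; apply/eqP.
apply: (iB _ (fun b => c b *+ (b \in s) - d b *+ (b \in t)) _ _ _ _ bu).
- exact: undup_uniq.
- by move=> z /=; rewrite mem_undup mem_cat => /orP[/sB|/tB].
- under eq_bigr do
    rewrite scalerBl -!scalerMnl -(count_uniq_mem _ us) -(count_uniq_mem _ ut).
  rewrite sumrB -!sum_count ?undup_uniq //.
  + by rewrite eq_st subrr.
  + by move=> z zt; rewrite mem_undup mem_cat zt orbT.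
  + by move=> z zs; rewrite mem_undup mem_cat zs.
Qed.

End HamelRepresentation.

Lemma is_norm_L_refl (R : realType) (k : scalar_kind)
    (X : lmodType (scalars R k)) (f : X -> R) : is_norm f -> L f f.
Proof.
move=> f_norm; split; first by left.
exists 1; first exact: oner_neq0.
by apply/lefP => x; rewrite /norm_scale modulus1 mul1r.
Qed.

(** * Weighted l^1-norms and their comparison *)

Section WeightedNorm.
Variables (R : realType) (k : scalar_kind) (X : lmodType (scalars R k)).
Variable B : set X.

(** The default pair is returned only for an [x] without representation, which a Hamel basis
    excludes. *)
Definition representation (x : X) : seq X * (X -> scalars R k) :=
  xget ([::], fun=> 0) [set p | [/\ uniq p.1, [set` p.1] `<=` B &
                                 x = \sum_(b <- p.1) p.2 b *: b]].

(* Independent of the chosen representation, by [weighted_norm_sum]. *)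
Definition weighted_norm (w : X -> R) (x : X) : R :=
  \sum_(b <- (representation x).1) w b * modulus ((representation x).2 b).

Hypothesis hB : hamel_basis B.

Lemma weighted_norm_sum w (s : seq X) c : uniq s -> [set` s] `<=` B ->
  weighted_norm w (\sum_(b <- s) c b *: b) = \sum_(b <- s) w b * modulus (c b).
Proof.
move=> us sB; rewrite /weighted_norm /representation.
case: xgetP => [[t d] _ [/= ut tB eq_st]|/(_ (s, c))[]//].
have cd := representation_unique hB us ut sB tB eq_st.
pose u := undup (s ++ t).
rewrite (sum_count (t := u)) ?undup_uniq //; last first.
  by move=> b bt; rewrite mem_undup mem_cat bt orbT.
rewrite [RHS](sum_count (t := u)) ?undup_uniq //; last first.
  by move=> b bs; rewrite mem_undup mem_cat bs.
apply: eq_bigr => b _; rewrite !count_uniq_mem // -!mulrnAr; congr (_ * _).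
have modMn (a : scalars R k) (i : bool) : modulus a *+ i = modulus (a *+ i).
  by case: i; rewrite ?mulr0n ?modulus0.
by rewrite !modMn cd.
Qed.

Lemma weighted_norm_basis w b : B b -> weighted_norm w b = w b.
Proof.
move=> Bb.
have := @weighted_norm_sum w [:: b] (fun=> 1).
rewrite !big_seq1 scale1r modulus1 mulr1; apply => // z /=.
by rewrite inE => /eqP ->.
Qed.

Lemma weighted_norm_is_norm w : (forall b, 0 < w b) ->
  is_norm (weighted_norm w).
Proof.
move=> w0; have wm0 b (a : scalars R k) : 0 <= w b * modulus a.
  by rewrite mulr_ge0 ?modulus_ge0 // ltW.
split.
- by move=> x; apply: sumr_ge0.
- move=> x; have [t [c [_ [ut tB -> _]]]] := common_representation hB x x.
  rewrite weighted_norm_sum // => /eqP; rewrite psumr_eq0 // => /allP h.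
  rewrite big_seq big1 // => b /h /=.
  by rewrite mulf_eq0 gt_eqF //= => /eqP/modulus0_eq0 ->; rewrite scale0r.
- move=> a x; have [t [c [_ [ut tB -> _]]]] := common_representation hB x x.
  rewrite scaler_sumr; under eq_bigr do rewrite scalerA.
  rewrite !weighted_norm_sum // mulr_sumr.
  by apply: eq_bigr => b _; rewrite modulusM mulrCA.
- move=> x y; have [t [c [d [ut tB -> ->]]]] := common_representation hB x y.
  rewrite -big_split /=; under eq_bigr do rewrite -scalerDl.
  rewrite !weighted_norm_sum // -big_split /=; apply: ler_sum => b _.
  by rewrite -mulrDr ler_pM2l // modulusD.
Qed.

(** Evaluation at the basis vectors, where the norms equal their weights, with [e] the modulus of
    the scalar. *)
Lemma L_weighted_norm w v : L (weighted_norm w) (weighted_norm v) ->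
  exists2 e : R, 0 < e & forall b, B b -> e * w b <= v b.
Proof.
move=> [_ [a a0 /lefP le_wv]]; exists (modulus a).
  rewrite lt_neqAle modulus_ge0 andbT eq_sym.
  by apply: contra a0 => /eqP/modulus0_eq0 ->.
by move=> b Bb; have := le_wv b; rewrite /norm_scale !weighted_norm_basis.
Qed.

End WeightedNorm.

(** * Injections, an oscillating weight, and the unit interval *)

Lemma card_le_injP (T U : Type) (A : set U) :
  [set: T] #<= A <-> exists2 f : T -> U, injective f & forall x, A (f x).
Proof.
split=> [/card_leP/unsquash f|[f finj fA]].
  exists (fun x => val (f (SigSub (mem_setT x)))); last by move=> x; exact: set_valP.
  by move=> x y /val_inj/(@inj _ _ _ f _ _ (mem_setT _) (mem_setT _)) [].
apply: card_le_trans (subset_card_le (A := range f) _).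
  by rewrite (card_le_eqr (inj_card_eq (in2W finj))) card_lexx.
by move=> _ [x _ <-].
Qed.

(** Along an injective sequence in [B], the weight is [n + 1] at odd [n] and its inverse at even
    [n]. *)
Lemma oscillating_weight (R : realType) (T : Type) (B : set T) :
  infinite_set B -> exists u : T -> R, [/\ forall b, 0 < u b,
    forall e, 0 < e -> exists2 b, B b & u b < e &
    forall M, exists2 b, B b & M < u b].
Proof.
move=> /infiniteP/card_le_injP[f finj fB].
(* Off the sequence the default index 0 gives the weight 1. *)
pose N b := xget 0%N [set n | f n = b].
have NK n : N (f n) = n.
  by rewrite /N; case: xgetP => [m _ /finj //|/(_ n)[]].
pose m b : R := (N b).+1%:R.
have m0 b : 0 < m b by rewrite ltr0n.
have m_gt x p : exists2 n, odd n = p & x < m (f n).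
  exists (p + (Num.bound `|x|).*2)%N; first by rewrite oddD odd_double addbF; case: p.
  rewrite /m NK (le_lt_trans (ler_norm x)) //.
  rewrite (lt_le_trans (archi_boundP (normr_ge0 x))) // ler_nat.
  by rewrite -addnn addnA leqW // leq_addl.
exists (fun b => if odd (N b) then m b else (m b)^-1); split.
- by move=> b; case: ifP; rewrite ?invr_gt0.
- move=> e e0; have [n n_even ltn] := m_gt e^-1 false.
  exists (f n); first exact: fB.
  by rewrite NK n_even invf_plt ?posrE.
- move=> M; have [n n_odd ltn] := m_gt M true.
  by exists (f n); [exact: fB|rewrite NK n_odd].
Qed.

(** Nonnegative reals go into (0, 1/2] and negative ones into (2/3, 1), so the two injective
    branches cannot collide. *)
Lemma real_inj_unit_interval (R : realType) :
  exists2 s : R -> R, injective s & forall r, 0 < s r < 1.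
Proof.
have small (x : R) : 2 <= x -> 0 < x^-1 <= 2^-1.
  by move=> x2; rewrite invr_gt0 lef_pV2 ?posrE; lra.
exists (fun r => if 0 <= r then (2 + r)^-1 else 1 - (3 - r)^-1).
  move=> r r'; have := small (2 + r); have := small (2 + r').
  have small3 (x : R) : 3 < x -> x^-1 < 3^-1.
    by move=> x2; rewrite ltf_pV2 ?posrE; lra.
  have := small3 (3 - r); have := small3 (3 - r').
  case: (lerP 0 r) => r0; case: (lerP 0 r') => r'0 h1 h2 h3 h4.
  - by move/invr_inj/addrI.
  - by have := h3; lra.
  - by lra.
  - by move/addrI/oppr_inj/invr_inj/addrI/oppr_inj.
move=> r; case: (lerP 0 r) => r0.
  by have := small (2 + r); lra.
by have := small (3 - r); lra.
Qed.

Theorem theorem6p8 (R : realType) (k : scalar_kind)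
    (X : lmodType (scalars R k)) (aleph : Type)
    (aleph_infinite : infinite_set [set: aleph])
    (dimX : has_dim X aleph) :
  [set: set aleph * R] #<= orderly_independent_norm_pairs X.
Proof.
have [B hB Baleph] := dimX.
have /card_le_injP[j jinj jB] : [set: aleph] #<= B.
  by rewrite -(card_le_eql Baleph) card_lexx.
have infB : infinite_set B.
  by apply/infiniteP; rewrite (card_le_eqr Baleph); apply/infiniteP.
have [u [u0 u_small u_large]] := oscillating_weight R infB.
have [s sinj s01] := real_inj_unit_interval R.
(* The parameter t is [s p.2], and A is the image of [p.1] under [j]. The factor lies between 1 and
   3, so [w p] inherits the large and small values of [u]. *)
pose w (p : set aleph * R) b : R := u b * (1 + s p.2 + `[< (j @` p.1) b >]%:R).
have i01 (b : bool) : 0 <= (b%:R : R) <= 1 by case: b => /=; lra.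
have w_bounds p b : u b <= w p b <= 3 * u b.
  rewrite /w ler_peMr ?(ltW (u0 b)) //= 1?mulrC ?ler_pM2r //;
    by have := s01 p.2; have := i01 `[< (j @` p.1) b >]; lra.
have w0 p b : 0 < w p b by have := w_bounds p b; have := u0 b; lra.
have w_inj p q : (forall b, B b -> w p b = w q b) -> p = q.
  move=> pq.
  have {}pq a : s p.2 = s q.2 /\ (p.1 a <-> q.1 a).
    have /(mulfI (lt0r_neq0 (u0 _))) := pq _ (jB a); rewrite !image_inj //.
    have := s01 p.2; have := s01 q.2.
    (* If the memberships differed, two numbers of (0, 1) would differ by 1. *)
    case: asboolP => pa; case: asboolP => qa /= *; split=> //; lra.
  (* Reading off t takes one point of [aleph]. *)
  have [a _] := infinite_setN0 aleph_infinite.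
  rewrite [p]surjective_pairing [q]surjective_pairing; congr (_, _).
    by apply/funext => b; apply/propext; case: (pq b).
  by apply: sinj; case: (pq a).
have one_indep p : ~ L (weighted_norm B (w p)) (weighted_norm B (cst 1)).
  move=> /(L_weighted_norm hB)[e e0 h].
  (* At this [b], [1 < e * u b <= e * w p b], against [e * w p b <= 1]. *)
  have [b Bb] := u_large e^-1; rewrite -div1r ltr_pdivrMr // mulrC => ub.
  have /andP[uw _] := w_bounds p b; have /le_trans := h b Bb.
  by move/(_ _ (lexx _)); rewrite leNgt (lt_le_trans ub) // ler_pM2l.
have indep_one p : ~ L (weighted_norm B (cst 1)) (weighted_norm B (w p)).
  move=> /(L_weighted_norm hB)[e e0 h].
  (* The 3 is the upper bound of the factor: [w p b <= 3 * u b < e], against [e <= w p b]. *)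
  have [|b Bb ub] := u_small (e / 3); first lra.
  by have := w_bounds p b; have := h b Bb; rewrite /cst; lra.
have norm_one : is_norm (weighted_norm B (cst 1)).
  by apply: weighted_norm_is_norm => // _; exact: ltr01.
have norm_w p := weighted_norm_is_norm hB (w0 p).
have norm_space_neq0 (v : X -> R) :
    (forall b, 0 < v b) -> is_norm (weighted_norm B v) ->
    (@norm_space R k X `\ cst 0) (weighted_norm B v).
  move=> v0 v_norm; split; first by left.
  have [b Bb _] := u_large 0.
  move=> /(congr1 (@^~ b)); rewrite weighted_norm_basis // => vb.
  by have := v0 b; rewrite vb /cst ltxx.
apply/card_le_injP.
exists (fun p => [set weighted_norm B (cst 1); weighted_norm B (w p)]).
  move=> p q pq; apply: w_inj => b Bb.
  (* Equal unordered pairs could match the norm of [w p] with the fixed norm; independence excludes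
     this, since a norm lies in its own [L]. *)
  have [p1|wpq] : [set weighted_norm B (cst 1); weighted_norm B (w q)]
      (weighted_norm B (w p)) by rewrite -pq; right.
    by case: (indep_one p); rewrite p1; exact: is_norm_L_refl.
  by rewrite -(weighted_norm_basis hB (w p) Bb) wpq (weighted_norm_basis hB _ Bb).
move=> p; exists (weighted_norm B (cst 1)), (weighted_norm B (w p)).
split; [exact: norm_one|exact: norm_w| |by []].
split; [|exact: norm_space_neq0| exact: one_indep | exact: indep_one].
by apply: norm_space_neq0 => // b; exact: ltr01.
Qed.
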